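(* Let $r\in(0,\infty)$ and let $u\in\operatorname{dom}\Delta_r$. Let $x$ be a junction point, $x=F_wq_i=F_{w'}q_j$ with $|w|=|w'|$, where $F_wSG$ and $F_{w'}SG$ are the two distinct cells of level $|w|$ meeting at $x$, and put $y_1=F_wq_{i-1}$, $y_3=F_{w'}q_{j-1}$. Then the local normal derivatives $\partial_{n,r}^wu(F_wq_i)$ and $\partial_{n,r}^{w'}u(F_{w'}q_j)$ exist, and $$\partial_{n,r}^wu(F_wq_i)+\partial_{n,r}^{w'}u(F_{w'}q_j)=0\quad\text{if } \mathrm{res}_{|w|}(x,y_1)=\mathrm{res}_{|w|}(x,y_3),$$ $$r\,\partial_{n,r}^wu(F_wq_i)+\partial_{n,r}^{w'}u(F_{w'}q_j)=0\quad\text{if } r\,\mathrm{res}_{|w|}(x,y_1)=\mathrm{res}_{|w|}(x,y_3).$$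
   Context: Let $q_0,q_1,q_2$ be the vertices of a triangle in the plane, $F_i(x)=\tfrac12(x-q_i)+q_i$, and $F_{ij}=F_i\circ F_j$ for $i,j\in\{0,1,2\}$; indices of the $q_i$ are cyclic mod 3. The Sierpinski gasket $SG$ is the unique nonempty compact set with $SG=\bigcup_{i,j}F_{ij}SG$. Put $V_0=\{q_0,q_1,q_2\}$ (the boundary), $V_{m+1}=\bigcup_{i,j}F_{ij}V_m$, $V_*=\bigcup_m V_m$; points of $V_*\setminus V_0$ are junction points. A word of length $|w|=m$ is $w=(w_1,\dots,w_m)$ with each $w_k\in\{ij: i,j\in\{0,1,2\}\}$, and $F_w=F_{w_1}\circ\dots\circ F_{w_m}$; $F_wSG$ is a cell of level $m$. The graph $\Gamma_m$ has vertex set $V_m$ and an edge $x\sim_m y$ when $x=F_wq_j$, $y=F_wq_k$ for some $|w|=m$, $j\ne k$. Fix $r\in(0,\infty)$ and set $D(r)=9r^2+26r+15$, $r_0(r)=\frac{6r(r+2)}{D(r)}$, $r_1(r)=\frac{6(r+2)}{D(r)}$, $\mu_0(r)=\frac1{3(2r+1)}$, $\mu_1(r)=\frac r{3(2r+1)}$. Resistances: $\mathrm{res}_0(x,y)=1$ on edges of $\Gamma_0$, and $\mathrm{res}_{m+1}(F_{ij}x,F_{ij}y)=r_0(r)\,\mathrm{res}_m(x,y)$ if $i=j$, $=r_1(r)\,\mathrm{res}_m(x,y)$ if $i\neq j$. (All edges of a given cell have the same resistance.) Energy: $\mathcal{E}_{r,m}(u,v)=\sum_{x\sim_m y}\mathrm{res}_m(x,y)^{-1}(u(x)-u(y))(v(x)-v(y))$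 (each edge counted once), $\mathcal{E}_r(u,v)=\lim_{m\to\infty}\mathcal{E}_{r,m}(u,v)$; $\operatorname{dom}\mathcal{E}_r$ is the set of (continuous) functions $u$ on $SG$ with $\mathcal{E}_r(u,u)<\infty$. Measure: $\mu_r$ is the self-similar Borel probability measure on $SG$ with $\mu_r(F_{ij}A)=\mu_0(r)\mu_r(A)$ if $i=j$ and $=\mu_1(r)\mu_r(A)$ if $i\ne j$. Laplacian: $u\in\operatorname{dom}\Delta_r$ with $\Delta_ru=f$ means that $u\in\operatorname{dom}\mathcal{E}_r$, $f$ is continuous on $SG$, and $-\mathcal{E}_r(u,v)=\int_{SG}vf\,d\mu_r$ for all $v\in\operatorname{dom}\mathcal{E}_r$ vanishing on $V_0$. Normal derivative: with $\lambda_{\mathrm{sym}}(r)=r_0(r)$, $$\partial_{n,r}u(q_i)=\lim_{m\to\infty}\lambda_{\mathrm{sym}}(r)^{-m}\bigl(2u(q_i)-u(F_{ii}^mq_{i+1})-u(F_{ii}^mq_{i-1})\bigr),$$ and the local normal derivative at $F_wq_i$ with respect to the cell $F_wSG$ is $\partial_{n,r}^wu(F_wq_i)=\lambda_{\mathrm{sym}}(r)^{-|w|}\,\partial_{n,r}(u\circ F_w)(q_i)$. *)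

(* Defs.v *)
From HB Require Import structures.
From mathcomp Require Import all_boot all_order all_algebra.
From mathcomp Require Import all_classical all_reals all_analysis.

Set Implicit Arguments.
Unset Strict Implicit.
Unset Printing Implicit Defensive.

Import Order.TTheory GRing.Theory Num.Theory.
Import numFieldNormedType.Exports.

Local Open Scope classical_set_scope.
Local Open Scope ring_scope.

(* Functions on SG are represented by functions on the whole plane, of which
   only the values on SG are ever used; continuity is continuity within SG. *)
Notation plane R := ('rV[R]_2).

Notation borel_plane R := (g_sigma_algebraType (@open (plane R))).

(* Vertices are indexed by 'I_3 with its ring structure, i.e. modulo 3. *)
Definition letter : Type := ('I_3 * 'I_3)%type.

Definition word : Type := seq letter.

Section Gasket.
Variables (R : realType) (q : 'I_3 -> plane R).
Implicit Types (x y : plane R) (u v f : plane R -> R) (i j k : 'I_3).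
Implicit Types (a : letter) (w : word) (m : nat).

Definition is_triangle : Prop := row_free (col_mx (q 1 - q 0) (q 2 - q 0)).

Definition F i x : plane R := 2^-1 *: (x - q i) + q i.

Definition F2 a : plane R -> plane R := F a.1 \o F a.2.

Definition Fw w : plane R -> plane R := foldr (fun a g => F2 a \o g) id w.

Definition is_gasket (SG : set (plane R)) : Prop :=
  [/\ SG !=set0, compact SG & SG = \bigcup_(a in [set: letter]) (F2 a @` SG)].

Fixpoint V m : set (plane R) :=
  if m is m'.+1 then \bigcup_(a in [set: letter]) (F2 a @` V m') else range q.

Definition Vstar : set (plane R) := \bigcup_m V m.

Definition junction x : Prop := (Vstar `\` V 0) x.

Definition edge m x y : Prop :=
  exists w j k, [/\ size w = m, j != k, x = Fw w (q j) & y = Fw w (q k)].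

Variable r : R.

Definition Dr : R := 9 * r ^+ 2 + 26 * r + 15.
Definition r0 : R := 6 * r * (r + 2) / Dr.
Definition r1 : R := 6 * (r + 2) / Dr.
Definition mu0 : R := (3 * (2 * r + 1))^-1.
Definition mu1 : R := r / (3 * (2 * r + 1)).

(* Every edge of Gamma_m lies in exactly one cell of level m, so these
   equations determine [res m] on the edges of Gamma_m (and nowhere else). *)
Definition is_resistance (res : nat -> plane R -> plane R -> R) : Prop :=
  (forall x y, edge 0 x y -> res 0 x y = 1) /\
  (forall m a x y, edge m x y ->
     res m.+1 (F2 a x) (F2 a y) =
       (if a.1 == a.2 then r0 else r1) * res m x y).

Variable res : nat -> plane R -> plane R -> R.

(* The sum runs over ordered pairs, so each edge is met twice: hence 1/2. *)
Definition energy_at m u v : R :=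
  2^-1 * \sum_(e \in [set e : plane R * plane R | edge m e.1 e.2])
           (res m e.1 e.2)^-1 * (u e.1 - u e.2) * (v e.1 - v e.2).

Definition energy u v : R := limn (fun m => energy_at m u v).

Variable SG : set (plane R).

(* [energy_at m u u] is nondecreasing in m, so its limit always exists in
   [0, +oo]; it is finite exactly when the sequence converges in R. *)
Definition dom_energy u : Prop :=
  {within SG, continuous u} /\ cvgn (fun m => energy_at m u u).

Definition is_selfsimilar_measure (mu : probability (borel_plane R) R) : Prop :=
  mu SG = 1%E /\
  (forall a (A : set (borel_plane R)), measurable A -> A `<=` SG ->
     mu (F2 a @` A) = ((if a.1 == a.2 then mu0 else mu1)%:E * mu A)%E).

Variable mu : probability (borel_plane R) R.

Definition has_laplacian u f : Prop :=
  [/\ dom_energy u, {within SG, continuous f} &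
    forall v, dom_energy v -> (forall i, v (q i) = 0) ->
      - energy u v = \int[mu]_(x in SG) (v x * f x)].

Definition dom_laplacian u : Prop := exists f, has_laplacian u f.

Definition lambda_sym : R := r0.

Definition normal_quotient u i m : R :=
  lambda_sym ^- m *
    (2 * u (q i) - u (iter m (F2 (i, i)) (q (i + 1)))
                 - u (iter m (F2 (i, i)) (q (i - 1)))).

Definition has_normal_derivative u i : Prop := cvgn (normal_quotient u i).

Definition normal_derivative u i : R := limn (normal_quotient u i).

Definition has_local_normal_derivative w u i : Prop :=
  has_normal_derivative (u \o Fw w) i.

Definition local_normal_derivative w u i : R :=
  lambda_sym ^- size w * normal_derivative (u \o Fw w) i.

End Gasket.

(* Main.v *)
Require Import Defs.
From HB Require Import structures.
From mathcomp Require Import all_boot all_order all_algebra.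
From mathcomp Require Import all_classical all_reals all_analysis.
From mathcomp Require Import ring lra zify.

(* The weak equation for the Laplacian is tested against functions which are
   harmonic on all cells of some level n: for such a test function h,
   Kirchhoff's law gives E_m(u, h) = E_n(u, h) for every u and every m >= n,
   whence E(u, h).
   With C_m = w(ii)^m and Q_m the difference quotient at level m, two choices
   suffice.
   - The half tent on C_m minus the half tent on C_{m+1} vanishes at x, hence is
     an admissible test function supported in the single cell C_m. It shows
     |Q_m - Q_{m+1}| <= const * mu(C_m), and mu(C_m) decays geometrically, so
     the normal derivative exists.
   - The tent at x, supported in C_m and in its counterpart C'_m, shows
     Q_m / res(w) + Q'_m / res(w') = - \int h f = O(mu(C_m) + mu(C'_m)), which
     tends to 0; this is the matching condition, for all values of the two
     resistances at once. *)

Set Implicit Arguments.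
Unset Strict Implicit.
Unset Printing Implicit Defensive.

Import Order.TTheory GRing.Theory Num.Theory.
Import numFieldNormedType.Exports.

Local Open Scope classical_set_scope.
Local Open Scope ring_scope.

(** * Case analysis and sums over the three indices *)

Lemma I3_ind (P : 'I_3 -> Prop) : P 0 -> P 1 -> P 2 -> forall i, P i.
Proof.
move=> P0 P1 P2 [[|[|[|//]]] lti].
- by rewrite (_ : Ordinal lti = 0) //; exact/val_inj.
- by rewrite (_ : Ordinal lti = 1) //; exact/val_inj.
- by rewrite (_ : Ordinal lti = 2) //; exact/val_inj.
Qed.

Lemma sum_I3 (V : zmodType) (g : 'I_3 -> V) : \sum_i g i = g 0 + g 1 + g 2.
Proof.
rewrite big_ord_recl big_ord_recl big_ord_recl big_ord0 addr0 addrA.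
by congr (g _ + g _ + g _); exact/val_inj.
Qed.

(** * Barycentric geometry of the cells *)

Section Geometry.
Variables (R : realType) (q : 'I_3 -> plane R).
Hypothesis hq : is_triangle q.
Implicit Types (x y : plane R) (i j k l : 'I_3) (a b : letter) (w s t : word).

Definition frame : 'M[R]_2 := col_mx (q 1 - q 0) (q 2 - q 0).

Definition affine_coord x : 'rV[R]_2 := (x - q 0) *m invmx frame.

Definition bary k x : R :=
  let c := affine_coord x in
  if k == 0 then 1 - c 0 0 - c 0 1 else if k == 1 then c 0 0 else c 0 1.

Lemma frame_unit : frame \in unitmx.
Proof. by rewrite -row_free_unit. Qed.

Lemma bary_inj x y : (forall k, bary k x = bary k y) -> x = y.
Proof.
move=> exy; have e1 := exy 1; have e2 := exy 2.
rewrite /bary /= in e1 e2.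
have : affine_coord x = affine_coord y.
  by apply/rowP; case=> [[|[|//]] lti];
    [rewrite (_ : Ordinal lti = 0)|rewrite (_ : Ordinal lti = 1)] => //;
    exact/val_inj.
move=> /(congr1 (mulmx^~ frame)).
by rewrite /affine_coord !(mulmxKV frame_unit) => /addIr.
Qed.

Lemma bary_sum x : bary 0 x + bary 1 x + bary 2 x = 1.
Proof. by rewrite /bary /=; ring. Qed.

Lemma affine_coord_q :
  [/\ affine_coord (q 0) = 0, affine_coord (q 1) = delta_mx 0 0
    & affine_coord (q 2) = delta_mx 0 1].
Proof.
have row1 : q 1 - q 0 = (delta_mx 0 0 : 'rV[R]_2) *m frame.
  rewrite /frame; have -> : (0 : 'I_2) = lshift 1 (0 : 'I_1) by exact/val_inj.
  rewrite -[RHS](@rowE _ 2 2) [RHS](@rowKu _ 1 1 2).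
  by apply/rowP => j; rewrite !mxE; congr (q 1 _ _ - q 0 _ _); exact/val_inj.
have row2 : q 2 - q 0 = (delta_mx 0 1 : 'rV[R]_2) *m frame.
  rewrite /frame; have -> : (1 : 'I_2) = rshift 1 (0 : 'I_1) by exact/val_inj.
  rewrite -[RHS](@rowE _ 2 2) [RHS](@rowKd _ 1 1 2).
  by apply/rowP => j; rewrite !mxE; congr (q 2 _ _ - q 0 _ _); exact/val_inj.
rewrite /affine_coord subrr mul0mx row1 row2.
by split=> //; rewrite mulmxK // frame_unit.
Qed.

Lemma bary_q k i : bary k (q i) = (k == i)%:R.
Proof.
have [e0 e1 e2] := affine_coord_q; rewrite /bary.
by elim/I3_ind: i; rewrite ?e0 ?e1 ?e2; elim/I3_ind: k;
  rewrite /= !mxE /= ?subr0 ?subrr ?sub0r ?addNr.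
Qed.

Lemma bary_F k i x : bary k (F q i x) = 2^-1 * (bary k x + (k == i)%:R).
Proof.
have -> : (k == i)%:R = bary k (q i) by rewrite bary_q.
have aff : affine_coord (F q i x)
           = 2^-1 *: (affine_coord x + affine_coord (q i)).
  rewrite /affine_coord -mulmxDl scalemxAl; congr (_ *m _).
  by apply/rowP => j; rewrite /F !mxE; field.
rewrite /bary aff !mxE.
by case: ifP => _; [field|case: ifP].
Qed.

Lemma F_inj i : injective (F q i).
Proof.
move=> x y exy; apply: bary_inj => k.
have /(congr1 (bary k)) := exy; rewrite !bary_F.
by move=> /mulfI e; apply/addIr/e; rewrite invr_eq0 pnatr_eq0.
Qed.

Lemma F2_inj a : injective (F2 q a).
Proof. by move=> x y /F_inj/F_inj. Qed.

Lemma Fw_inj w : injective (Fw q w).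
Proof. by elim: w => [//|a w ih] x y /F2_inj/ih. Qed.

Lemma q_inj : injective q.
Proof.
move=> i j eij; have := bary_q i j; rewrite -eij bary_q eqxx.
by case: eqP => // _ /eqP; rewrite oner_eq0.
Qed.

Lemma Fw_cat s t x : Fw q (s ++ t) x = Fw q s (Fw q t x).
Proof. by elim: s => //= a s ih; rewrite ih. Qed.

Lemma Fw_rcons s a x : Fw q (rcons s a) x = Fw q s (F2 q a x).
Proof. by rewrite -cats1 Fw_cat. Qed.

Lemma F_q i : F q i (q i) = q i.
Proof. by rewrite /F subrr scaler0 add0r. Qed.

Lemma Fw_nseq m k : Fw q (nseq m (k, k)) (q k) = q k.
Proof. by elim: m => //= m ->; rewrite /F2 /= !F_q. Qed.

(* The closed solid triangle: it contains the gasket, its cells are easier to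
   separate than those of the gasket. *)
Definition tri x : Prop := forall k, 0 <= bary k x.

Lemma tri_q i : tri (q i).
Proof. by move=> k; rewrite bary_q ler0n. Qed.

Lemma tri_F i x : tri x -> tri (F q i x).
Proof.
by move=> tx k; rewrite bary_F mulr_ge0 // ?addr_ge0 // invr_ge0 ler0n.
Qed.

Lemma tri_F2 a x : tri x -> tri (F2 q a x).
Proof. by move=> tx; do 2!apply: tri_F. Qed.

Lemma tri_Fw w x : tri x -> tri (Fw q w x).
Proof. by elim: w => //= a w ih /ih; exact: tri_F2. Qed.

Lemma tri_le1 x k : tri x -> bary k x <= 1.
Proof.
move=> tx; have := bary_sum x.
have := tx 0; have := tx 1; have := tx 2.
by elim/I3_ind: k => *; lra.
Qed.

Lemma tri_eq_q x i : tri x -> 1 <= bary i x -> x = q i.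
Proof.
move=> tx xi; apply: bary_inj => k; rewrite bary_q.
have := bary_sum x; have := tx 0; have := tx 1; have := tx 2.
move: xi; elim/I3_ind: i => xi; elim/I3_ind: k => /= *; lra.
Qed.

(** Corners are extreme points of the triangle: the [k]-th coordinate of [F q j x] is the mean of
    two numbers at most 1, so it equals 1 only when both do. *)
Lemma F_eq_q j x k : tri x -> F q j x = q k -> j = k /\ x = q k.
Proof.
move=> tx e; have := congr1 (bary k) e; rewrite bary_F bary_q eqxx {e}.
case: eqP => [kj bk|_ bk]; last first.
  by exfalso; have := tri_le1 k tx; rewrite /= in bk *; lra.
split=> //; apply: tri_eq_q => //; rewrite /= in bk; lra.
Qed.

Lemma F2_eq_q a x k : tri x -> F2 q a x = q k -> a = (k, k) /\ x = q k.
Proof.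
case: a => i j tx /(F_eq_q (tri_F j tx))[/= -> /F_eq_q].
by move=> /(_ tx)[-> ->].
Qed.

Lemma Fw_eq_q w x k :
  tri x -> Fw q w x = q k -> w = nseq (size w) (k, k) /\ x = q k.
Proof.
move=> tx; elim: w => [//|a w ih] /= /(F2_eq_q (tri_Fw w tx))[-> /ih].
by case=> <- ->.
Qed.

(** The [i]-th coordinate is at least 1/2 on the image of [F q i] and at most 1/2 on that of
    [F q j], so equality holds in both; likewise for [j]. *)
Lemma F_meet i j x y : tri x -> tri y -> i != j -> F q i x = F q j y ->
  x = q j /\ y = q i.
Proof.
move=> tx ty ij e.
have := congr1 (bary i) e; have := congr1 (bary j) e.
rewrite !bary_F !eqxx (eq_sym j) (negbTE ij) /= => bj bi.
clear e ij; have := tri_le1 i ty; have := tri_le1 j tx.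
have := tx i; have := ty j.
by move=> *; split; apply: tri_eq_q => //; lra.
Qed.

(* The letter of the other cell of level 1 that contains [F2 a (q k)]. *)
Definition opposite a k : letter := if a.2 == k then (k, a.1) else (a.1, k).

(** With equal first indices the meeting point lies inside one half-size triangle; with different
    ones it is the midpoint of a side of the large triangle. The two branches of [opposite] are
    these two cases. *)
Lemma F2_meet a b x y : tri x -> tri y -> a != b -> F2 q a x = F2 q b y ->
  exists k l, [/\ x = q k, y = q l & b = opposite a k].
Proof.
case: a b => [i j] [k l] tx ty; rewrite /F2 /=.
have [<-|ik] := eqVneq i k => ab.
  move=> /F_inj e.
  have jl : j != l by apply: contraNneq ab => ->; exact: eqxx.
  by have [-> ->] := F_meet tx ty jl e; exists l, j;
    rewrite /opposite /= (negbTE jl).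
move=> /(F_meet (tri_F _ tx) (tri_F _ ty) ik)[].
move=> /(F_eq_q tx)[-> ->] /(F_eq_q ty)[-> ->].
by exists k, i; rewrite /opposite /= eqxx.
Qed.

(** [opposite a k = a] happens exactly for [a = (k, k)], where [F2 q a (q k)] is a corner of the
    large triangle and has no second cell. *)
Lemma opposite_inj a k l : opposite a k != a -> opposite a k = opposite a l ->
  k = l.
Proof.
case: a => i j; rewrite /opposite /=.
have [<-|jk] := eqVneq j k; have [<-|jl] := eqVneq j l => //.
- by move=> + [ji _]; rewrite ji eqxx.
- by move=> _ [ij ki]; rewrite ki ij eqxx in jk.
- by move=> _ [].
Qed.

(** At the first letter where [s] and [t] differ, the meeting point is a corner of both cells;
    through the remaining letters a corner can only come from a corner. *)
Lemma Fw_meet s t x y : tri x -> tri y -> size s = size t -> s != t ->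
  Fw q s x = Fw q t y -> exists k l, x = q k /\ y = q l.
Proof.
move=> tx ty; elim: s t => [[]//|a s ih] [//|b t] [st] /=.
have [<-|ab _] := eqVneq a b.
  rewrite eqseq_cons eqxx /= => snt /F2_inj; exact: ih.
move=> /(F2_meet (tri_Fw _ tx) (tri_Fw _ ty) ab)[k [l [ek el _]]].
by exists k, l; split; [have [] := Fw_eq_q tx ek|have [] := Fw_eq_q ty el].
Qed.

(** Common letters cancel; at the first difference the letter [b = opposite a k] determines [k],
    hence the point. *)
Lemma Fw_meet_uniq s t x y x' y' : tri x -> tri y -> tri x' -> tri y' ->
  size s = size t -> s != t ->
  Fw q s x = Fw q t y -> Fw q s x' = Fw q t y' -> x = x'.
Proof.
move=> tx ty tx' ty'; elim: s t => [[]//|a s ih] [//|b t] [st] /=.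
have [<-|ab _] := eqVneq a b.
  by rewrite eqseq_cons eqxx /= => snt /F2_inj e /F2_inj e'; exact: ih e e'.
move=> /(F2_meet (tri_Fw _ tx) (tri_Fw _ ty) ab)[k [l [ek el ob]]].
move=> /(F2_meet (tri_Fw _ tx') (tri_Fw _ ty') ab)[k' [l' [ek' el' ob']]].
apply: (@Fw_inj s); rewrite ek ek'; congr q.
by apply: (@opposite_inj a); rewrite -ob // eq_sym.
Qed.

Lemma Fw_nseq_eq s t k l m : size s = size t ->
  Fw q s (q l) = q k -> Fw q t (q m) = q k -> s = t.
Proof.
move=> st /(Fw_eq_q (tri_q l))[-> _] /(Fw_eq_q (tri_q m))[-> _].
by rewrite st.
Qed.

(** At a vertex of the cell [a] the only other cell is [opposite a m], so at the first split two of
    the three words share their letter. Their remaining letters agree because a single word of given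
    length reaches a given corner. *)
Lemma Fw_meet3 s t z i j k : size s = size t -> size s = size z ->
  Fw q s (q i) = Fw q t (q j) -> Fw q s (q i) = Fw q z (q k) ->
  [\/ s = t, s = z | t = z].
Proof.
have tq w l := tri_Fw w (tri_q l).
elim: s t z => [|a s ih] [|b t] [|c z] //=; first by move=> *; apply: Or31.
move=> [st] [sz].
have [<-|ab] := eqVneq a b.
  have [<-|ac] := eqVneq a c.
    by move=> /F2_inj e /F2_inj e'; have [->|->|->] := ih _ _ st sz e e';
      [apply: Or31|apply: Or32|apply: Or33].
  move=> + /(F2_meet (tq _ _) (tq _ _) ac)[m [l [em _ _]]].
  move=> /F2_inj; rewrite em => /esym e.
  by apply: Or31; congr cons; exact: Fw_nseq_eq em e.
move=> e e'; have [m [l [em el ob]]] := F2_meet (tq _ _) (tq _ _) ab e.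
have [ac|ac] := eqVneq a c.
  apply: Or32; congr cons => //; move: e'; rewrite -ac => /F2_inj; rewrite em.
  by move=> /esym e'; exact: Fw_nseq_eq em e'.
have [m' [l' [em' _ oc]]] := F2_meet (tq _ _) (tq _ _) ac e'.
have mm' : m = m' by apply: q_inj; rewrite -em -em'.
have bc : b = c by rewrite ob oc mm'.
move: e; rewrite e' -bc => /F2_inj; rewrite el => e.
apply: Or33; congr cons => //; apply: Fw_nseq_eq el e.
by rewrite -st.
Qed.

End Geometry.

(** * Harmonic extension from V_0 to Gamma_1 *)

Section Extension.
Variables (R : realType) (r : R).
Hypothesis r_gt0 : 0 < r.
Implicit Types (a : letter) (i j k l : 'I_3) (f g : 'I_3 -> R).

(* [coef a k l * Dr r] is the weight of the boundary value at [q l] in the value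
   at [F2 a (q k)] of the harmonic extension, obtained by solving the Kirchhoff
   equations of Gamma_1; the four kinds of vertices of Gamma_1 are the corners
   [q i], the midpoints of the sides, the vertices adjacent to a corner, and the
   vertices of the hexagons facing a corner. *)
Definition coef a k l : R :=
  let: (i, j) := a in
  (if i == j then
     if k == i then (if l == i then Dr r else 0)
     else if l == i then 3 * r ^+ 2 + 14 * r + 15
     else if l == k then 3 * r ^+ 2 + 7 * r else 3 * r ^+ 2 + 5 * r
   else if k == j then
     if (l == i) || (l == j) then 3 * r ^+ 2 + 10 * r + 7
     else 3 * r ^+ 2 + 6 * r + 1
   else if k == i then
     if l == i then 3 * r ^+ 2 + 14 * r + 15
     else if l == j then 3 * r ^+ 2 + 7 * r else 3 * r ^+ 2 + 5 * r
   else if l == i then 3 * r ^+ 2 + 12 * r + 11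
   else 3 * r ^+ 2 + 7 * r + 2) / Dr r.

Definition ext f a k : R := \sum_l coef a k l * f l.

Lemma Dr_gt0 : 0 < Dr r.
Proof. by have := r_gt0; rewrite /Dr; nra. Qed.

Lemma Dr_neq0 : Dr r != 0.
Proof. by rewrite gt_eqF // Dr_gt0. Qed.

Lemma coef_ge0 a k l : 0 <= coef a k l.
Proof.
have r0 := r_gt0; have r2 : 0 <= r ^+ 2 by rewrite exprn_ge0 // ltW.
case: a => i j; rewrite /coef divr_ge0 ?(ltW Dr_gt0) //.
do ![case: ifP => _]; rewrite ?(ltW Dr_gt0) //; lra.
Qed.

(** A lower bound, uniform in [a] and [k], for the weight of [q a.1]; 7 is the smallest constant
    term among the numerators of [coef a k a.1]. *)
Definition gain : R := 7 / Dr r.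

Lemma gain_bounds : 0 < gain < 1.
Proof.
rewrite divr_gt0 ?Dr_gt0 //= ltr_pdivrMr ?Dr_gt0 // mul1r /Dr.
by have := r_gt0; nra.
Qed.

Lemma coef_ge_gain a k : gain <= coef a k a.1.
Proof.
have r0 := r_gt0; have r2 : 0 <= r ^+ 2 by rewrite exprn_ge0 // ltW.
case: a => i j; rewrite /coef /gain ler_pM2r ?invr_gt0 ?Dr_gt0 //= eqxx /=.
by do ![case: ifP => _]; rewrite /Dr; lra.
Qed.

Lemma coef_sum a k : \sum_l coef a k l = 1.
Proof.
have D0 := Dr_neq0; case: a => i j; rewrite sum_I3.
elim/I3_ind: i; elim/I3_ind: j; elim/I3_ind: k;
  rewrite /coef /= -!mulrDl -[RHS](divff D0); congr (_ / _); rewrite /Dr; ring.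
Qed.

(** The share [gain] is set apart for [f a.1]; the other weights stay nonnegative and add up to
    [1 - gain]. *)
Lemma ext_le f a k t : (forall l, f l <= t) ->
  ext f a k <= gain * f a.1 + (1 - gain) * t.
Proof.
move=> ft; rewrite -lerBlDl -subr_ge0.
have -> : (1 - gain) * t - (ext f a k - gain * f a.1)
  = \sum_l (coef a k l - (l == a.1)%:R * gain) * (t - f l).
  have S1 : \sum_l (l == a.1)%:R * gain * (t - f l) = gain * (t - f a.1).
    rewrite (bigD1 a.1) //= eqxx big1 ?addr0 ?mul1r // => i /negbTE ->.
    by rewrite !mul0r.
  under eq_bigr do rewrite mulrBl mulrBr.
  rewrite sumrB S1 sumrB -mulr_suml coef_sum -/(ext f a k). ring.
apply: sumr_ge0 => l _; rewrite mulr_ge0 ?subr_ge0 //.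
by case: eqP => [->|_]; rewrite ?mul1r ?mul0r ?coef_ge_gain ?coef_ge0.
Qed.

Lemma extN f a k : ext (fun l => - f l) a k = - ext f a k.
Proof. by rewrite /ext -sumrN; apply: eq_bigr => l _; rewrite mulrN. Qed.

Lemma ext_ge f a k t : (forall l, t <= f l) ->
  gain * f a.1 + (1 - gain) * t <= ext f a k.
Proof.
move=> tf; have := @ext_le (fun l => - f l) a k (- t).
rewrite extN => le; have := le (fun l => ltac:(by rewrite lerN2)).
by move=> {le}; lra.
Qed.

Lemma ext_le_max f a t : (forall l, f l <= t) -> forall k, ext f a k <= t.
Proof.
move=> ft k; apply: le_trans (ext_le a k ft) _.
by have := gain_bounds; have := ft a.1; nra.
Qed.

Lemma ext_ge_min f a t : (forall l, t <= f l) -> forall k, t <= ext f a k.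
Proof.
move=> tf k; apply: le_trans (ext_ge a k tf).
by have := gain_bounds; have := tf a.1; nra.
Qed.

Lemma I3_argmax f : exists i, forall l, f l <= f i.
Proof.
have [i _ im] := @arg_maxP _ _ _ (0 : 'I_3) xpredT f isT.
by exists i => l; exact: im.
Qed.

Lemma I3_argmin f : exists i, forall l, f i <= f l.
Proof.
have [i _ im] := @arg_minP _ _ _ (0 : 'I_3) xpredT f isT.
by exists i => l; exact: im.
Qed.

Definition osc f (c : R) : Prop := forall k l, f k <= f l + c.

(** The upper bound by the maximum and the lower bound by the minimum share the summand
    [gain * f a.1], which cancels in the difference. *)
Lemma ext_osc f a c : osc f c -> osc (ext f a) ((1 - gain) * c).
Proof.
move=> fc k l; have [i im] := I3_argmax f; have [j jm] := I3_argmin f.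
have := ext_le a k im; have := ext_ge a l jm; have := fc i j.
by have := gain_bounds; nra.
Qed.

Lemma ext_corner f k : ext f (k, k) k = f k.
Proof.
have D0 := Dr_neq0; rewrite /ext (bigD1 k) //=.
rewrite big1 ?addr0 ?eqxx ?divff ?mul1r //.
by move=> l /negbTE ->; rewrite mul0r mul0r.
Qed.

(** A finite check of the table [coef]; it makes the nine pieces glue to one function on Gamma_1. *)
Lemma ext_opposite f i j k l : (i, j) != (k, l) ->
  forall m n, (k, l) = opposite (i, j) m -> (i, j) = opposite (k, l) n ->
  ext f (i, j) m = ext f (k, l) n.
Proof.
move=> + m n; rewrite /opposite /=.
elim/I3_ind: i; elim/I3_ind: j; elim/I3_ind: m;
  elim/I3_ind: n; move=> + /= [-> ->] //=;
  rewrite /ext !sum_I3 /coef /= => _ //.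
Qed.

Definition dirichlet f g : R :=
  (f 0 - f 1) * (g 0 - g 1) + (f 1 - f 2) * (g 1 - g 2)
  + (f 2 - f 0) * (g 2 - g 0).

Definition scale a : R := if a.1 == a.2 then r0 r else r1 r.

Lemma r0_gt0 : 0 < r0 r.
Proof. by rewrite divr_gt0 ?Dr_gt0 //; have := r_gt0; nra. Qed.

Lemma scale_gt0 a : 0 < scale a.
Proof.
rewrite /scale; case: ifP => _; first exact: r0_gt0.
by rewrite divr_gt0 ?Dr_gt0 //; have := r_gt0; nra.
Qed.

Lemma F_sym (q : 'I_3 -> plane R) i j : F q i (q j) = F q j (q i).
Proof. by apply/rowP => k; rewrite /F !mxE; field. Qed.

Lemma sum_letter (V : zmodType) (G : letter -> V) :
  \sum_(a : letter) G a = \sum_i \sum_j G (i, j).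
Proof. by rewrite pair_big; apply: eq_bigr => -[]. Qed.

(* Kirchhoff's law at the vertices of Gamma_1 that are not in V_0. *)
Lemma ext_harmonic (q : 'I_3 -> plane R) (u : plane R -> R) f :
  \sum_(a : letter)
     (scale a)^-1 * dirichlet (fun k => u (F2 q a (q k))) (ext f a)
  = dirichlet (fun k => u (q k)) f.
Proof.
have D0 := Dr_neq0; have r20 : r + 2 != 0 by have := r_gt0; lra.
have r_neq0 : r != 0 by rewrite gt_eqF.
have eD : 9 * r ^+ 2 + 26 * r + 15 != 0 by exact: D0.
rewrite sum_letter !sum_I3 /dirichlet /F2 /= !F_q.
(* A vertex shared by two cells has two addresses; these rewrites leave one, so that [u] takes a
   single value there. *)
rewrite !(F_sym q 1 0) !(F_sym q 2 0) !(F_sym q 2 1).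
rewrite /ext !sum_I3 /coef /scale /r0 /r1 /=.
by rewrite /Dr; field; rewrite eD r20 r_neq0.
Qed.

End Extension.

(** * Harmonic splines *)

Lemma norm_le_geometric_eq0 (R : realType) (x z C : R) : 0 <= z < 1 ->
  (forall m : nat, `|x| <= z ^+ m * C) -> x = 0.
Proof.
move=> /andP[z0 z1] xC; apply/normr0_eq0/le_anti; rewrite normr_ge0 andbT.
have lim0 : (fun m => z ^+ m * C) @ \oo --> (0 : R).
  rewrite -[X in _ --> X](mul0r C); apply: cvgMl.
  by apply: cvg_expr; rewrite ger0_norm.
by apply: (cvgr_to_ge lim0); apply: nearW => m; exact: xC.
Qed.

(** Letters are appended on the right, so that the words of length [m.+1] are grouped by the cell of
    level [m] that they subdivide. *)
Fixpoint words m : seq word :=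
  if m is m'.+1 then
    [seq rcons w a | w <- words m', a <- enum (('I_3 * 'I_3)%type : finType)]
  else [:: [::]].

Lemma mem_words m w : (w \in words m) = (size w == m).
Proof.
elim: m w => [|m ih] w /=; first by rewrite inE size_eq0.
apply/allpairsP/idP => [[[v a] /= [vm _ ->]]|].
  by rewrite size_rcons eqSS -ih.
case/lastP: w => [//|v a]; rewrite size_rcons eqSS -ih => vm.
by exists (v, a); rewrite /= mem_enum.
Qed.

Lemma words_uniq m : uniq (words m).
Proof.
elim: m => [//|m ih] /=; apply: allpairs_uniq => //; first exact: enum_uniq.
by move=> [v a] [v' a'] _ _ /= /rcons_inj[-> ->].
Qed.

Lemma sum_words_rcons (V : zmodType) m (G : word -> V) :
  \sum_(w <- words m.+1) G w
  = \sum_(w <- words m) \sum_(a : letter) G (rcons w a).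
Proof.
rewrite /= big_allpairs_dep; apply: eq_bigr => w _.
by rewrite -[RHS]big_enum.
Qed.

Lemma sum_words_pred1 (V : zmodType) m w (G : word -> V) : size w = m ->
  (forall w', size w' = m -> w' != w -> G w' = 0) ->
  \sum_(w' <- words m) G w' = G w.
Proof.
move=> wm G0; rewrite (bigD1_seq w) ?words_uniq ?mem_words ?wm //=.
rewrite big_seq_cond big1 ?addr0 // => w' /andP[].
by rewrite mem_words => /eqP; exact: G0.
Qed.

Lemma ext_vertex (R : realType) (q : 'I_3 -> plane R) (hq : is_triangle q)
  (r : R) (f : 'I_3 -> R) a b k l :
  F2 q a (q k) = F2 q b (q l) -> ext r f a k = ext r f b l.
Proof.
move=> e; have [ab|ab] := eqVneq a b.
  by move: e; rewrite ab => /(F2_inj hq)/(q_inj hq) ->.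
have [k' [l' [/(q_inj hq) <- _ ob]]] :=
  F2_meet hq (tri_q hq k) (tri_q hq l) ab e.
have ba : b != a by rewrite eq_sym.
have [l'' [_ [/(q_inj hq) <- _ oa]]] :=
  F2_meet hq (tri_q hq l) (tri_q hq k) ba (esym e).
case: a b {e ba} ab ob oa => [i j] [i' j'] ab ob oa.
exact: (ext_opposite r _ ab ob oa).
Qed.

Section Spline.
Variables (R : realType) (q : 'I_3 -> plane R).
Hypothesis hq : is_triangle q.
Variable r : R.
Hypothesis r_gt0 : 0 < r.
Variables (n : nat) (G : word -> 'I_3 -> R) (M : R).
Hypothesis G_vertex : forall w w' k l, size w = n -> size w' = n ->
  Fw q w (q k) = Fw q w' (q l) -> G w k = G w' l.
Hypothesis G_le : forall w k, `|G w k| <= M.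
Implicit Types (x y : plane R) (w v : word) (k l : 'I_3).

(* Boundary values, on the cells of level at least [n], of the function which is
   harmonic on each cell of level [n], with boundary values [G]. *)
Definition bvalue w : 'I_3 -> R := foldl (ext r) (G (take n w)) (drop n w).

Lemma bvalue_rcons w a : (n <= size w)%N ->
  bvalue (rcons w a) = ext r (bvalue w) a.
Proof.
move=> nw; rewrite /bvalue -cats1 takel_cat // drop_cat.
case: ltnP => [nw'|wn]; first by rewrite foldl_cat.
have -> : n = size w by apply/eqP; rewrite eqn_leq nw wn.
by rewrite subnn drop0 drop_size.
Qed.

Lemma bvalue_level w : size w = n -> bvalue w = G w.
Proof. by move=> wn; rewrite /bvalue -wn take_size drop_size. Qed.

Lemma bvalue_cat (P : ('I_3 -> R) -> Prop) w v : (n <= size w)%N ->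
  (forall f a, P f -> P (ext r f a)) -> P (bvalue w) -> P (bvalue (w ++ v)).
Proof.
move=> + Pext; elim: v w => [|a v ih] w nw Pw; first by rewrite cats0.
rewrite -cat_rcons; apply: ih; first by rewrite size_rcons ltnW.
by rewrite bvalue_rcons //; exact: Pext.
Qed.

Lemma bvalue_corner w m k : (n <= size w)%N ->
  bvalue (w ++ nseq m (k, k)) k = bvalue w k.
Proof.
elim: m w => [|m ih] w nw; first by rewrite cats0.
rewrite /= -cat_rcons ih ?size_rcons 1?ltnW //.
by rewrite bvalue_rcons // ext_corner.
Qed.

(** If the parent cells coincide, this is [ext_vertex]; otherwise the point is a corner of both
    parents, and extension keeps corner values. *)
Lemma bvalue_vertex m w v k l : size w = (n + m)%N -> size v = (n + m)%N ->
  Fw q w (q k) = Fw q v (q l) -> bvalue w k = bvalue v l.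
Proof.
elim: m w v k l => [|m ih] w v k l.
  by rewrite addn0 => wn vn e; rewrite !bvalue_level //; exact: G_vertex.
case/lastP: w => [|w a]; first by rewrite addnS.
case/lastP: v => [|v b]; first by rewrite addnS.
rewrite !size_rcons addnS => -[wn] -[vn]; rewrite !Fw_rcons // => e.
have nw : (n <= size w)%N by rewrite wn leq_addr.
have nv : (n <= size v)%N by rewrite vn leq_addr.
rewrite !bvalue_rcons //.
have tq c j := tri_F2 hq c (tri_q hq j).
have [wv|wv] := eqVneq w v; last first.
  have [|k' [l' [ek el]]] := Fw_meet hq (tq a k) (tq b l) _ wv e.
    by rewrite wn vn.
  have [-> /(q_inj hq) ->] := F2_eq_q hq (tri_q hq k) ek.
  have [-> /(q_inj hq) ->] := F2_eq_q hq (tri_q hq l) el.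
  rewrite !ext_corner //; apply: ih => //.
  by rewrite -ek e el.
by move: e; rewrite wv => /(Fw_inj hq); exact: ext_vertex.
Qed.

Definition in_cell w x := (Fw q w @` tri q) x.

(** [v] is cut to the length of [w]. If the result is [w], the cells are nested; otherwise the cut
    cell meets [w] at a vertex, and [v] sits at that corner and keeps its value. *)
Lemma bvalue_meet w v x : (n <= size w)%N -> (size w <= size v)%N ->
  in_cell w x -> in_cell v x ->
  (exists k l, bvalue w k = bvalue v l) \/ (exists u, v = w ++ u).
Proof.
move=> nw wv [y ty <-] [z tz].
have sv : size (take (size w) v) = size w by rewrite size_takel.
rewrite -[v in Fw q v z](cat_take_drop (size w)) Fw_cat => e.
have [<-|vw] := eqVneq (take (size w) v) w.
  by right; exists (drop (size w) v); rewrite cat_take_drop.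
left; have [k [l [ek el]]] := Fw_meet hq (tri_Fw hq _ tz) ty sv vw e.
exists l, k; rewrite -[v](cat_take_drop (size w)).
have [-> _] := Fw_eq_q hq tz ek.
rewrite bvalue_corner ?sv //; apply: (@bvalue_vertex (size w - n)).
- by rewrite subnKC.
- by rewrite sv subnKC.
- by rewrite -ek -el.
Qed.

(** Maximum principle when one cell contains the other; a shared vertex value when they only
    touch. *)
Lemma bvalue_cmp w v x s t : (n <= size w)%N -> (n <= size v)%N ->
  in_cell w x -> in_cell v x -> (forall k, s <= bvalue w k) ->
  (forall k, bvalue v k <= t) -> s <= t.
Proof.
move=> nw nv wx vx sw vt; have [wv|/ltnW vw] := leqP (size w) (size v).
  have [[k [l e]]|[u e]] := bvalue_meet nw wv wx vx.
    by apply: le_trans (sw k) _; rewrite e.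
  apply: le_trans (vt 0); rewrite e.
  by apply: (@bvalue_cat (fun f => forall k, s <= f k)) => // f a;
    exact: ext_ge_min.
have [[k [l e]]|[u e]] := bvalue_meet nv vw vx wx.
  by apply: le_trans (sw l) _; rewrite -e.
apply: le_trans (sw 0) _; rewrite e.
by apply: (@bvalue_cat (fun f => forall k, f k <= t)) => // f a;
  exact: ext_le_max.
Qed.

(** The infimum, over the cells of level at least [n] containing [x], of the maximal boundary value:
    no address of [x] has to be chosen. By [bvalue_cmp] it also stays above the minimum on each such
    cell. *)
Definition spline x : R :=
  inf [set t | exists w,
    [/\ (n <= size w)%N, in_cell w x & forall k, bvalue w k <= t]].

Lemma spline_le w x t : (n <= size w)%N -> in_cell w x ->
  (forall k, bvalue w k <= t) -> spline x <= t.
Proof.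
move=> nw wx wt; apply: ge_inf; last by exists w.
have [i im] := I3_argmin (bvalue w); exists (bvalue w i) => s [v [nv vx vs]].
exact: bvalue_cmp nw nv wx vx im vs.
Qed.

Lemma spline_ge w x t : (n <= size w)%N -> in_cell w x ->
  (forall k, t <= bvalue w k) -> t <= spline x.
Proof.
move=> nw wx wt; apply: lb_le_inf.
  by have [i im] := I3_argmax (bvalue w); exists (bvalue w i), w.
by move=> s [v [nv vx vs]]; exact: bvalue_cmp nw nv wx vx wt vs.
Qed.

Lemma spline_osc w x c k : (n <= size w)%N -> in_cell w x ->
  osc (bvalue w) c -> `|spline x - bvalue w k| <= c.
Proof.
move=> nw wx wc; rewrite ler_distl; apply/andP; split.
  by apply: spline_ge nw wx _ => l; rewrite lerBlDr.
by apply: spline_le nw wx _ => l.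
Qed.

Lemma bvalue_osc w : (n <= size w)%N ->
  osc (bvalue w) ((1 - gain r) ^+ (size w - n) * (M *+ 2)).
Proof.
(* The bound starts at words of length [n], met either as the empty word or as the equality case for
   [rcons]. *)
elim/last_ind: w => [|w a ih].
  rewrite leqn0 => /eqP n0 k l; rewrite bvalue_level //= sub0n expr0 mul1r.
  have := G_le [::] k; have := G_le [::] l.
  by rewrite !ler_norml mulr2n => /andP[? ?] /andP[? ?]; lra.
rewrite leq_eqVlt size_rcons => /predU1P[e|]; last first.
  rewrite ltnS => nw; rewrite subSn // exprS -mulrA bvalue_rcons //.
  by apply: ext_osc => //; exact: ih.
rewrite bvalue_level ?size_rcons // -e subnn expr0 mul1r => k l.
have := G_le (rcons w a) k; have := G_le (rcons w a) l.
by rewrite !ler_norml mulr2n => /andP[? ?] /andP[? ?]; lra.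
Qed.

Lemma gain_onem : 0 <= 1 - gain r < 1.
Proof. by have := gain_bounds r_gt0; lra. Qed.

(** The cells [w ++ nseq (n + m) (k, k)] shrink to the vertex and keep its value, while their
    oscillation tends to 0. *)
Lemma spline_vertex w k : (n <= size w)%N ->
  spline (Fw q w (q k)) = bvalue w k.
Proof.
move=> nw; apply/subr0_eq.
apply: (norm_le_geometric_eq0 (C := M *+ 2) gain_onem) => m.
rewrite -(@bvalue_corner w (n + m) k) //.
have nw' : (n <= size (w ++ nseq (n + m) (k, k)))%N.
  by rewrite size_cat (leq_trans nw) // leq_addr.
apply: spline_osc => //.
  by exists (q k); [exact: tri_q|rewrite Fw_cat Fw_nseq].
move=> i j; apply: le_trans (bvalue_osc nw' i j) _.
rewrite lerD2l ler_wpM2r ?mulrn_wge0 ?(le_trans (normr_ge0 _) (G_le [::] 0)) //.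
have /andP[? /ltW ?] := gain_onem; apply: ler_wiXn2l => //.
by rewrite size_cat size_nseq leq_subRL //; lia.
Qed.

End Spline.

(** * Topology of the gasket and its cells *)

Section Gasket.
Variables (R : realType) (q : 'I_3 -> plane R).
Hypothesis hq : is_triangle q.
Variable SG : set (plane R).
Hypothesis hSG : is_gasket q SG.
Implicit Types (x y : plane R) (w : word).

Lemma bary_continuous k : continuous (bary q k : plane R -> R).
Proof.
have lin j : continuous (fun x => affine_coord q x 0 j).
  have -> : (fun x => affine_coord q x 0 j)
      = (fun x => \sum_(l < 2) (x 0 l - q 0 0 l) * invmx (frame q) l j).
    by apply/funext => x; rewrite mxE; apply: eq_bigr => l _; rewrite !mxE.
  apply: continuous_big => [|l _ x]; first exact: add_continuous.
  apply: (@continuousM _ _ (fun y => y 0 l - q 0 0 l) (cst _)).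
    apply: (@continuousB _ _ _ (fun y => y 0 l) (cst _)).
      exact: coord_continuous.
    exact: cst_continuous.
  exact: cst_continuous.
rewrite /bary; case: (k == 0) => x.
  apply: (@continuousB _ _ _ (fun x => 1 - affine_coord q x 0 0));
    last exact: lin.
  apply: (@continuousB _ _ _ (fun=> 1 : R) (fun x => affine_coord q x 0 0));
    last exact: lin.
  exact: cst_continuous.
by case: (k == 1); exact: lin.
Qed.

Lemma F_continuous i : continuous (F q i).
Proof.
move=> x; apply: (@continuousD _ _ _ (fun y => 2^-1 *: (y - q i)) (cst _)).
  apply: (@continuousZ _ _ _ (cst _) (fun y => y - q i)).
    exact: cst_continuous.
  apply: (@continuousB _ _ _ id (cst _)); first exact: cvg_id.
  exact: cst_continuous.
exact: cst_continuous.
Qed.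

Lemma Fw_continuous w : continuous (Fw q w).
Proof.
elim: w => [|a w ih] x; first exact: cvg_id.
apply: continuous_comp; first exact: ih.
by apply: continuous_comp; exact: F_continuous.
Qed.

(** At a minimum point [c] of [bary q k] on the gasket, self-similarity gives [bary q k c] at least
    a quarter of itself, so the minimum is nonnegative. *)
Lemma gasket_tri x : SG x -> tri q x.
Proof.
move=> SGx k; have [SG0 cSG eSG] := hSG.
have [|c SGc cm] := @EVT_min_rV R 2 (bary q k) SG SG0 cSG.
  by apply: continuous_subspaceT; exact: bary_continuous.
apply: le_trans (cm x _); last by rewrite inE.
have : SG c by rewrite inE in SGc.
rewrite {1}eSG => -[a _ [y SGy ec]].
have := cm y; rewrite inE => /(_ SGy).
rewrite -ec /F2 /= !bary_F //.
by case: (k == a.1); case: (k == a.2) => /=; lra.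
Qed.

Lemma gasket_Fw w x : SG x -> SG (Fw q w x).
Proof.
have [_ _ eSG] := hSG; elim: w => [//|a w ih] SGx /=.
by rewrite eSG; exists a => //; exists (Fw q w x) => //; exact: ih.
Qed.

Lemma gasket_cover m x : SG x ->
  exists2 w, w \in words m & (Fw q w @` SG) x.
Proof.
have [_ _ eSG] := hSG; elim: m x => [|m ih] x SGx.
  by exists [::]; rewrite ?inE //; exists x.
have [w wm [y SGy <-]] := ih _ SGx.
move: SGy; rewrite {1}eSG => -[a _ [z SGz <-]].
exists (rcons w a); first by move: wm; rewrite !mem_words size_rcons eqSS.
by exists z; rewrite ?Fw_rcons.
Qed.

Lemma gasket_closed_cell w : closed (Fw q w @` SG).
Proof.
have [_ cSG _] := hSG; apply: compact_closed; first exact: norm_hausdorff.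
apply: continuous_compact cSG.
by apply: continuous_subspaceT; exact: Fw_continuous.
Qed.

Lemma gasket_closed : closed SG.
Proof.
by have [_ cSG _] := hSG; apply: compact_closed; first exact: norm_hausdorff.
Qed.

(* The cells of level [m] avoiding [x] form a closed set: near [x], every point
   of the gasket shares a cell of level [m] with [x]. *)
Lemma gasket_near m x : SG x ->
  \forall y \near within SG (nbhs x),
    exists2 w, size w = m & (Fw q w @` SG) x /\ (Fw q w @` SG) y.
Proof.
move=> SGx.
pose A := [set w | w \in [seq w <- words m | `[< ~ (Fw q w @` SG) x >]]].
pose Z := \bigcup_(w in A) (Fw q w @` SG).
have cZ : closed Z.
  by apply: closed_bigcup => [|w _];
    [exact: finite_seq|exact: gasket_closed_cell].
have : nbhs x (~` Z).
  apply: open_nbhs_nbhs; split; first by rewrite openC.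
  by move=> [w]; rewrite /A /= mem_filter => /andP[/asboolP].
rewrite near_withinE; apply: filterS => y Zy SGy.
have [w wm wy] := gasket_cover m SGy.
exists w; first by apply/eqP; rewrite -mem_words.
split=> //; apply: contrapT => wx; apply: Zy.
by exists w => //; rewrite /A /= mem_filter wm andbT; apply/asboolP.
Qed.

(** * Continuity, support and bounds of splines on the gasket *)

Section GasketSpline.
Variable r : R.
Hypothesis r_gt0 : 0 < r.
Variables (n : nat) (G : word -> 'I_3 -> R) (M : R).
Hypothesis G_vertex : forall w w' k l, size w = n -> size w' = n ->
  Fw q w (q k) = Fw q w' (q l) -> G w k = G w' l.
Hypothesis G_le : forall w k, `|G w k| <= M.

Lemma spline_continuous : {within SG, continuous (spline q r n G)}.
Proof.
apply/subspace_continuousP => x SGx; apply/cvgrPdist_le => e e0.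
(* The 4 is 2 + 2: [x] and [y] are each compared with one vertex of a common cell of level
   [n + m]. *)
have lim0 : (fun m => (1 - gain r) ^+ m * (M *+ 4)) @ \oo --> (0 : R).
  rewrite -[X in _ --> X](mul0r (M *+ 4)); apply: cvgMl.
  by apply: cvg_expr; have /andP[? ?] := gain_onem r_gt0; rewrite ger0_norm.
have /cvgrPdist_le/(_ e e0)[m _ /(_ m (leqnn m))] := lim0.
rewrite /= sub0r normrN => me.
near=> y.
have : exists2 w, size w = (n + m)%N & (Fw q w @` SG) x /\ (Fw q w @` SG) y.
  by near: y; exact: gasket_near.
move=> [w wm [[x' SGx' ex] [y' SGy' ey]]].
have nw : (n <= size w)%N by rewrite wm leq_addr.
have osc_w := bvalue_osc r_gt0 G_le nw.
have wx : in_cell q w x by exists x' => //; exact: gasket_tri.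
have wy : in_cell q w y by exists y' => //; exact: gasket_tri.
have := spline_osc hq r_gt0 G_vertex 0 nw wx osc_w.
have := spline_osc hq r_gt0 G_vertex 0 nw wy osc_w.
move: me; rewrite wm addKn => /ler_normlP[_].
rewrite !ler_distl => me /andP[h1 h2] /andP[h3 h4].
have e4 : M *+ 4 = M *+ 2 + M *+ 2 by rewrite -mulrnDr.
move: me; rewrite e4 mulrDr => me.
apply/andP; split; lra.
Unshelve. all: by end_near. Qed.

Lemma spline_eq0 w x : (n <= size w)%N -> (forall k, bvalue r n G w k = 0) ->
  (Fw q w @` SG) x -> spline q r n G x = 0.
Proof.
move=> nw w0 [y SGy xy]; apply/le_anti/andP.
have wx : in_cell q w x by exists y => //; exact: gasket_tri.
by split; [apply: (spline_le hq r_gt0 G_vertex nw wx)|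
  apply: (spline_ge hq r_gt0 G_vertex nw wx)] => k; rewrite w0.
Qed.

Lemma spline_norm_le x : SG x -> `|spline q r n G x| <= M.
Proof.
move=> SGx; have [w] := gasket_cover n SGx.
rewrite mem_words => /eqP wn [y SGy xy].
have wx : in_cell q w x by exists y => //; exact: gasket_tri.
have nw : (n <= size w)%N by rewrite wn.
have Gw k : - M <= bvalue r n G w k /\ bvalue r n G w k <= M.
  by rewrite bvalue_level //; have := G_le w k; rewrite ler_norml => /andP[].
rewrite ler_norml; apply/andP.
by split; [apply: (spline_ge hq r_gt0 G_vertex nw wx)|
  apply: (spline_le hq r_gt0 G_vertex nw wx)] => k; have [] := Gw k.
Qed.

End GasketSpline.
End Gasket.

(** * Energy of a harmonic spline *)

Section Energy.
Variables (R : realType) (q : 'I_3 -> plane R).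
Hypothesis hq : is_triangle q.
Variable r : R.
Hypothesis r_gt0 : 0 < r.
Variable res : nat -> plane R -> plane R -> R.
Hypothesis hres : is_resistance q r res.
Implicit Types (u : plane R -> R) (w : word).

(** The common resistance of the edges of the cell [w]. *)
Definition weight w : R := \prod_(a <- w) scale r a.

Lemma weight_gt0 w : 0 < weight w.
Proof. by apply: prodr_gt0 => a _; exact: scale_gt0. Qed.

Lemma weight_rcons w a : weight (rcons w a) = weight w * scale r a.
Proof. by rewrite /weight big_rcons. Qed.

Lemma res_weight w j k : j != k ->
  res (size w) (Fw q w (q j)) (Fw q w (q k)) = weight w.
Proof.
have [res0 resS] := hres; move=> jk; elim: w => [|a w ih].
  by rewrite /weight big_nil res0 //; exists [::], j, k.
rewrite /= resS; first by rewrite ih /weight big_cons.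
by exists w, j, k.
Qed.

Definition sides : seq ('I_3 * 'I_3) :=
  [:: (0, 1); (1, 0); (1, 2); (2, 1); (2, 0); (0, 2)].

Lemma mem_sides j k : ((j, k) \in sides) = (j != k).
Proof. by elim/I3_ind: j; elim/I3_ind: k. Qed.

(** Each edge is listed in both orientations, which absorbs the factor 1/2 of [energy_at]. *)
Definition edges m : seq (plane R * plane R) :=
  [seq (Fw q w (q p.1), Fw q w (q p.2)) | w <- words m, p <- sides].

(** An edge lying in two cells would give them two common points, against [Fw_meet_uniq]. *)
Lemma edges_uniq m : uniq (edges m).
Proof.
apply: allpairs_uniq => //; first exact: words_uniq.
move=> [w [j k]] [w' [j' k']].
move=> /allpairsPdep[v [[c d] [vm cd [-> -> ->]]]].
move=> /allpairsPdep[v' [[c' d'] [vm' cd' [-> -> ->]]]].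
rewrite !mem_words in vm vm'; rewrite !mem_sides in cd cd'.
move=> [ej ek].
have [vv|vv] := eqVneq v v'.
  by rewrite vv in ej ek *; rewrite (q_inj hq (Fw_inj hq ej))
    (q_inj hq (Fw_inj hq ek)).
have tq i := tri_q hq i.
have sv : size v = size v' by rewrite (eqP vm) (eqP vm').
have /(q_inj hq) := Fw_meet_uniq hq (tq _) (tq _) (tq _) (tq _) sv vv ej ek.
by move=> e; rewrite e eqxx in cd.
Qed.

Lemma edge_edges m :
  [set e : plane R * plane R | edge q m e.1 e.2] = [set` edges m].
Proof.
apply/seteqP; split=> [[x y] /= [w [j [k [wm jk -> ->]]]]|[x y] /=].
  apply/allpairsP; exists (w, (j, k)) => /=.
  by rewrite mem_words wm eqxx mem_sides.
move=> /allpairsP[[w [j k]] /= [wm jk [-> ->]]].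
rewrite mem_words in wm; rewrite mem_sides in jk.
by exists w, j, k; split=> //; exact/eqP.
Qed.

Definition trace u w : 'I_3 -> R := fun k => u (Fw q w (q k)).

Lemma energy_atE m u v : energy_at q res m u v
  = \sum_(w <- words m) (weight w)^-1 * dirichlet (trace u w) (trace v w).
Proof.
rewrite /energy_at edge_edges -fsbig_seq ?edges_uniq // big_allpairs_dep.
rewrite mulr_sumr !big_seq; apply: eq_bigr => w; rewrite mem_words => /eqP wm.
rewrite /sides !big_cons big_nil /= -!wm !res_weight // /dirichlet /trace.
by field; rewrite gt_eqF ?weight_gt0.
Qed.

Section SplineEnergy.
Variables (n : nat) (G : word -> 'I_3 -> R) (M : R).
Hypothesis G_vertex : forall w w' k l, size w = n -> size w' = n ->
  Fw q w (q k) = Fw q w' (q l) -> G w k = G w' l.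
Hypothesis G_le : forall w k, `|G w k| <= M.

(** Induction on [m]: by [ext_harmonic] applied to [u \o Fw q w], the terms of the nine subcells of
    [w] add up to the term of [w]. *)
Lemma energy_at_spline u m : energy_at q res (n + m) u (spline q r n G)
  = \sum_(w <- words n) (weight w)^-1 * dirichlet (trace u w) (G w).
Proof.
have -> : energy_at q res (n + m) u (spline q r n G)
    = \sum_(w <- words (n + m))
        (weight w)^-1 * dirichlet (trace u w) (bvalue r n G w).
  rewrite energy_atE !big_seq; apply: eq_bigr => w.
  rewrite mem_words => /eqP wm.
  congr (_ * dirichlet _ _); apply/funext => k; rewrite /trace.
  by rewrite (spline_vertex hq r_gt0 G_vertex G_le) // wm leq_addr.
elim: m => [|m ih].
  rewrite addn0 !big_seq; apply: eq_bigr => w; rewrite mem_words => /eqP wm.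
  by rewrite bvalue_level.
rewrite -ih addnS sum_words_rcons !big_seq; apply: eq_bigr => w.
rewrite mem_words => /eqP wm.
rewrite -(ext_harmonic r_gt0 q (u \o Fw q w)) mulr_sumr; apply: eq_bigr => a _.
rewrite weight_rcons invfM -mulrA; congr (_ * (_ * dirichlet _ _)).
  by apply/funext => k; rewrite /trace Fw_rcons.
by rewrite bvalue_rcons // wm leq_addr.
Qed.

Lemma cvg_energy_at_spline u :
  (fun m => energy_at q res m u (spline q r n G)) @ \oo -->
    \sum_(w <- words n) (weight w)^-1 * dirichlet (trace u w) (G w).
Proof.
apply: cvg_near_cst; exists n => // m /= nm.
by rewrite -(subnKC nm) energy_at_spline.
Qed.

Lemma energy_spline u : energy q res u (spline q r n G)
  = \sum_(w <- words n) (weight w)^-1 * dirichlet (trace u w) (G w).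
Proof. exact: cvg_lim (cvg_energy_at_spline (u := u)). Qed.

Lemma dom_energy_spline SG : is_gasket q SG ->
  dom_energy q res SG (spline q r n G).
Proof.
move=> hSG; split; last exact: cvgP (cvg_energy_at_spline (u := _)).
exact: (spline_continuous hq hSG r_gt0 G_vertex G_le).
Qed.

End SplineEnergy.
End Energy.

(** * Integrals over cells *)

Section Measure.
Variables (R : realType) (q : 'I_3 -> plane R).
Hypothesis hq : is_triangle q.
Variable r : R.
Hypothesis r_gt0 : 0 < r.
Variable SG : set (plane R).
Hypothesis hSG : is_gasket q SG.
Variable mu : probability (borel_plane R) R.
Hypothesis hmu : is_selfsimilar_measure q r SG mu.

Lemma closed_measurable_plane (A : set (plane R)) : closed A ->
  measurable (A : set (borel_plane R)).
Proof.
move=> cA; rewrite -[A]setCK; apply: measurableC.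
by apply: sub_sigma_algebra; rewrite /= openC.
Qed.

Lemma mu0_lt1 : 0 <= mu0 r < 1.
Proof.
have r0 := r_gt0; rewrite /mu0 invr_ge0 invf_lt1; last lra.
by apply/andP; split; lra.
Qed.

Definition mass (w : word) : R :=
  \prod_(a <- w) (if a.1 == a.2 then mu0 r else mu1 r).

Lemma mu_cell w : mu (Fw q w @` SG) = (mass w)%:E.
Proof.
have [mu1 muS] := hmu; elim: w => [|a w ih].
  by rewrite /mass big_nil /= image_id.
rewrite /mass big_cons EFinM -ih -muS.
- by rewrite image_comp.
- by apply: closed_measurable_plane; exact: (gasket_closed_cell hSG).
- by move=> _ [x SGx <-]; exact: gasket_Fw.
Qed.

Lemma mass_nseq w m i : mass (w ++ nseq m (i, i)) = mass w * mu0 r ^+ m.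
Proof.
rewrite /mass big_cat /=; congr (_ * _); elim: m => [|m ih].
  by rewrite big_nil.
by rewrite /= big_cons ih exprS /= eqxx.
Qed.

Lemma within_continuous_measurable (g : plane R -> R) :
  {within SG, continuous g} ->
  measurable_fun (SG : set (borel_plane R)) (g : borel_plane R -> R).
Proof.
move=> /continuousP cg.
apply: (measurability _ (measurable_realfun.RGenOpens.measurableE R)).
move=> _ [_ [a [b ->] <-]].
have /cg/open_subspaceP[V oV VD] : open (`]a, b[%classic : set R).
  exact: interval_open.
rewrite setIC -VD; apply: measurableI.
  by apply: sub_sigma_algebra.
exact: closed_measurable_plane (gasket_closed hSG).
Qed.

Lemma within_continuous_bounded (g : plane R -> R) :
  {within SG, continuous g} ->
  exists2 K, 0 <= K & forall x, SG x -> `|g x| <= K.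
Proof.
have [_ cSG _] := hSG.
move=> /continuous_compact/(_ cSG)/compact_bounded[K [_ gK]].
(* The bound is provided only for numbers strictly above [K], hence the added 1. *)
exists (`|K| + 1) => [|x SGx]; first by rewrite addr_ge0.
by apply: gK; [rewrite ltr_pwDr // ler_norm|exists x].
Qed.

(** Two cells, because a tent at a junction point lives on two; a function carried by one cell is
    treated with [w' = w], at the cost of a factor 2. *)
Lemma Rintegral_le_cells (g : plane R -> R) (K : R) w w' :
  {within SG, continuous g} -> (forall x, SG x -> `|g x| <= K) ->
  (forall x, SG x -> ~ (Fw q w @` SG) x -> ~ (Fw q w' @` SG) x -> g x = 0) ->
  0 <= K -> `|\int[mu]_(x in SG) g x| <= K * (mass w + mass w').
Proof.
move=> cg gK g0 K0; set C := Fw q w @` SG `|` Fw q w' @` SG.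
have mcell v := closed_measurable_plane (gasket_closed_cell hSG (w := v)).
have mC : measurable (C : set (borel_plane R)) by exact: measurableU.
have mSG := closed_measurable_plane (gasket_closed hSG).
have CSG : C `<=` SG by move=> _ [] [x SGx <-]; exact: gasket_Fw.
have ig : mu.-integrable SG (EFin \o g).
  apply: measurable_bounded_integrable => //.
  - by rewrite (le_lt_trans (probability_le1 _ _)) // ltry.
  - exact: within_continuous_measurable.
  - exists K; split; [exact: num_real|move=> x Kx y SGy].
    exact: le_trans (gK y SGy) (ltW Kx).
have iC : mu.-integrable C (EFin \o g) by exact: integrableS ig.
have -> : \int[mu]_(x in SG) g x = \int[mu]_(x in C) g x.
  rewrite -[C in RHS](setIidr CSG) Rintegral_mkcondr.
  apply: eq_Rintegral => x; rewrite inE => SGx.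
  rewrite patchE; case: ifPn => //; rewrite notin_setE => /not_orP[].
  exact: g0.
apply: le_trans (le_normr_Rintegral mC iC) _.
have muC : fine (mu C) <= mass w + mass w'.
  rewrite -lee_fin fineK ?fin_num_measure // EFinD -!mu_cell.
  by apply: measureU2; exact: mcell.
apply: le_trans (ler_wpM2l K0 muC); rewrite -Rintegral_cst //.
apply: le_Rintegral => //.
- exact: integrable_norm.
- by apply: finite_measure_integrable_cst.
- by move=> x /CSG; exact: gK.
Qed.

End Measure.

(** * Test functions and normal derivatives *)

Section Matching.
Variables (R : realType) (q : 'I_3 -> plane R).
Hypothesis hq : is_triangle q.
Variable r : R.
Hypothesis r_gt0 : 0 < r.
Variable SG : set (plane R).
Hypothesis hSG : is_gasket q SG.
Variable res : nat -> plane R -> plane R -> R.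
Hypothesis hres : is_resistance q r res.
Variable mu : probability (borel_plane R) R.
Hypothesis hmu : is_selfsimilar_measure q r SG mu.
Variables u f : plane R -> R.
Hypothesis hu : has_laplacian q res SG mu u f.
Variable K : R.
Hypothesis K_ge0 : 0 <= K.
Hypothesis f_le : forall x, SG x -> `|f x| <= K.
Implicit Types (i j k l : 'I_3) (v w : word) (a : letter).

Lemma gasket_off_cell n (G : word -> 'I_3 -> R) M v v' x :
  (forall w w' k l, size w = n -> size w' = n ->
    Fw q w (q k) = Fw q w' (q l) -> G w k = G w' l) ->
  (forall w, size w = n ->
    take (size v) w != v -> take (size v') w != v' -> forall k, G w k = 0) ->
  (forall w k, `|G w k| <= M) ->
  SG x -> ~ (Fw q v @` SG) x -> ~ (Fw q v' @` SG) x -> spline q r n G x = 0.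
Proof.
move=> G_vertex G0 G_le SGx vx v'x.
have [w + wx] := gasket_cover hSG n SGx; rewrite mem_words => /eqP wn.
apply: (spline_eq0 hq hSG r_gt0 G_vertex _ _ wx); first by rewrite wn.
have off z : ~ (Fw q z @` SG) x -> take (size z) w != z.
  move=> zx; apply/eqP => wz; apply: zx; have [y SGy <-] := wx.
  exists (Fw q (drop (size z) w) y); first exact: gasket_Fw.
  by rewrite -{1}wz -Fw_cat cat_take_drop.
by rewrite bvalue_level //; apply: G0 => //; exact: off.
Qed.

(** The sum is E(u, h) for the spline [h] of [G], hence up to sign the integral of [h * f], where
    [h] is bounded by [M], [f] by [K], and [h] vanishes off the two cells. *)
Lemma weak_form_bound n (G : word -> 'I_3 -> R) M v v' :
  (forall w w' k l, size w = n -> size w' = n ->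
    Fw q w (q k) = Fw q w' (q l) -> G w k = G w' l) ->
  (forall w k, `|G w k| <= M) ->
  (forall l, G (nseq n (l, l)) l = 0) ->
  (forall w, size w = n ->
    take (size v) w != v -> take (size v') w != v' -> forall k, G w k = 0) ->
  `|\sum_(w <- words n) (weight r w)^-1 * dirichlet (trace q u w) (G w)|
    <= M * K * (mass r v + mass r v').
Proof.
move=> G_vertex G_le G_bd G0.
have M0 : 0 <= M := le_trans (normr_ge0 _) (G_le [::] 0).
pose h := spline q r n G; have [_ cf weak] := hu.
have dom_h := dom_energy_spline hq r_gt0 hres G_vertex G_le hSG.
have h0 l : h (q l) = 0.
  rewrite /h -(Fw_nseq q n l).
  rewrite (spline_vertex hq r_gt0 G_vertex G_le) ?size_nseq //.
  by rewrite bvalue_level ?size_nseq.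
rewrite -(energy_spline hq r_gt0 hres G_vertex G_le) -normrN weak //.
apply: (Rintegral_le_cells hSG hmu).
- have [ch _] := dom_h => x.
  by apply: (@continuousM _ _ (h : subspace SG -> R) (f : subspace SG -> R));
    [exact: ch|exact: cf].
- move=> x SGx; rewrite normrM ler_pM ?f_le //.
  exact: (spline_norm_le hq hSG r_gt0 G_vertex G_le).
- move=> x SGx vx v'x; rewrite (gasket_off_cell G_vertex G0 G_le SGx vx v'x).
  by rewrite mul0r.
- by rewrite mulr_ge0.
Qed.

Definition kronecker i : 'I_3 -> R := fun k => (k == i)%:R.

(** The unnormalised difference quotient at the corner [i] of the cell [v], written as a Dirichlet
    pairing so that test functions produce it directly. *)
Definition outflow v i : R := dirichlet (trace q u v) (kronecker i).

Lemma outflowE v i : outflow v i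
  = 2 * u (Fw q v (q i)) - u (Fw q v (q (i + 1))) - u (Fw q v (q (i - 1))).
Proof.
have e : [/\ 1 + 1 = 2 :> 'I_3, 2 + 1 = 0 :> 'I_3, - 1 = 2 :> 'I_3,
    1 - 1 = 0 :> 'I_3 & 2 - 1 = 1 :> 'I_3] by split; exact/val_inj.
have [e1 e2 e3 e4 e5] := e.
rewrite /outflow /dirichlet /trace /kronecker.
by elim/I3_ind: i; rewrite ?add0r ?e1 ?e2 ?e4 ?e5 ?e3 /=; ring.
Qed.

Lemma dirichletBr (g g1 g2 : 'I_3 -> R) :
  dirichlet g (fun k => g1 k - g2 k) = dirichlet g g1 - dirichlet g g2.
Proof. by rewrite /dirichlet; ring. Qed.

Section OneCell.
Variables (v : word) (i : 'I_3).
Hypothesis v_notin : forall l, Fw q v (q i) <> q l.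

(* The half tent at [Fw q v (q i)] carried by the cell [v], minus the half tent
   carried by its subcell at that point: the difference vanishes at the point,
   so that its extension by zero outside the cell [v] is continuous. *)
Definition half_tent_diff w : 'I_3 -> R := fun k =>
  if take (size v) w == v then
    let a := last (0, 0) w in
    ext r (kronecker i) a k - (F2 q a (q k) == q i)%:R
  else 0.

(** When the parent cells differ, the shared vertex is a corner of each; there both half tents take
    the same value, so the difference is 0 on either side. *)
Lemma half_tent_diff_vertex w w' k l :
  size w = (size v).+1 -> size w' = (size v).+1 ->
  Fw q w (q k) = Fw q w' (q l) -> half_tent_diff w k = half_tent_diff w' l.
Proof.
case/lastP: w => [//|w a]; case/lastP: w' => [//|w' a'].
rewrite !size_rcons => -[wv] -[w'v]; rewrite !Fw_rcons => e.
rewrite /half_tent_diff !last_rcons -!cats1 -{1}wv -w'v !take_size_cat //.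
have [ww|ww] := eqVneq w w'.
  move: e; rewrite ww => /(Fw_inj hq) e; case: ifP => // _.
  by rewrite (ext_vertex hq r (kronecker i) e) e.
have tq b m := tri_F2 hq b (tri_q hq m).
have [|c [d [ec ed]]] := Fw_meet hq (tq a k) (tq a' l) _ ww e.
  by rewrite wv.
have corner b m n : F2 q b (q m) = q n ->
    ext r (kronecker i) b m - (F2 q b (q m) == q i)%:R = 0.
  move=> e'; have [-> /(q_inj hq) ->] := F2_eq_q hq (tri_q hq m) e'.
  by rewrite ext_corner // /F2 /= !F_q (inj_eq (q_inj hq)) subrr.
by rewrite (corner _ _ _ ec) (corner _ _ _ ed); case: ifP; case: ifP.
Qed.

Lemma half_tent_diff_le w k : `|half_tent_diff w k| <= 1.
Proof.
rewrite /half_tent_diff; case: ifP => _; last by rewrite normr0.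
have d01 l : 0 <= kronecker i l /\ kronecker i l <= 1.
  by rewrite /kronecker; case: (l == i).
have := ext_le_max r_gt0 (last (0, 0) w) (fun l => (d01 l).2) k.
have := ext_ge_min r_gt0 (last (0, 0) w) (fun l => (d01 l).1) k.
by rewrite ler_norml; case: (_ == _) => /= *; apply/andP; split; lra.
Qed.

Lemma half_tent_diff_boundary l :
  half_tent_diff (nseq (size v).+1 (l, l)) l = 0.
Proof.
rewrite /half_tent_diff; case: eqP => // ev.
have -> : last (0, 0) (nseq (size v).+1 (l, l)) = (l, l) :> letter.
  by elim: (size v) => [|n] /=.
rewrite ext_corner // /F2 /= !F_q (inj_eq (q_inj hq)) /kronecker.
case: eqP => [li|]; last by rewrite subrr.
case: (v_notin (l := i)); rewrite -ev take_nseq ?leqW // li.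
exact: Fw_nseq.
Qed.

Lemma outflow_step :
  `|(weight r v)^-1 * (outflow v i - (r0 r)^-1 * outflow (rcons v (i, i)) i)|
    <= K * (mass r v + mass r v).
Proof.
have sumE : (weight r v)^-1
      * (outflow v i - (r0 r)^-1 * outflow (rcons v (i, i)) i)
    = \sum_(w <- words (size v).+1)
        (weight r w)^-1 * dirichlet (trace q u w) (half_tent_diff w).
  rewrite sum_words_rcons (sum_words_pred1 (w := v)) //; last first.
    move=> w wv wv'; apply: big1 => a _.
    rewrite (_ : half_tent_diff _ = fun=> 0); last first.
      apply/funext => k; rewrite /half_tent_diff -cats1 -wv.
      by rewrite take_size_cat // (negbTE wv').
    by rewrite /dirichlet; ring.
  have terms a : (weight r (rcons v a))^-1 *
      dirichlet (trace q u (rcons v a)) (half_tent_diff (rcons v a))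
    = (weight r v)^-1 * ((scale r a)^-1 *
         dirichlet (fun k => (u \o Fw q v) (F2 q a (q k)))
           (ext r (kronecker i) a))
      - (weight r v)^-1 * ((scale r a)^-1 *
         dirichlet (trace q u (rcons v a)) (fun k => (F2 q a (q k) == q i)%:R)).
    rewrite weight_rcons invfM -mulrA -mulrBr -mulrBr; congr (_ * (_ * _)).
    have -> : (fun k => (u \o Fw q v) (F2 q a (q k))) = trace q u (rcons v a).
      by apply/funext => k; rewrite /trace Fw_rcons.
    rewrite -dirichletBr; congr dirichlet; apply/funext => k.
    by rewrite /half_tent_diff last_rcons -cats1 take_size_cat // eqxx.
  under eq_bigr do rewrite terms.
  (* Kirchhoff's law turns the nine terms of the half tent on [v] into [outflow v i]. *)
  rewrite sumrB -!mulr_sumr ext_harmonic // mulrBr; congr (_ - _ * _).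
  (* Only the subcell [(i, i)] contains the corner [q i], and its resistance factor is [r0 r]. *)
  rewrite (bigD1 (i, i)) //= big1 ?addr0; last first.
    move=> a ai; rewrite (_ : (fun k => _) = fun=> 0).
      by rewrite /dirichlet; ring.
    apply/funext => k; case: eqP => // /(F2_eq_q hq (tri_q hq k))[ea _].
    by rewrite ea eqxx in ai.
  rewrite /scale /= eqxx; congr (_ * dirichlet _ _); apply/funext => k.
  have eF : F2 q (i, i) (q i) = q i by rewrite /F2 /= !F_q.
  rewrite /kronecker -[X in _ = (_ == X)%:R]eF.
  by rewrite (inj_eq (F2_inj hq (a:=(i, i)))) (inj_eq (q_inj hq)).
rewrite sumE -[K]mul1r; apply: weak_form_bound.
- exact: half_tent_diff_vertex.
- exact: half_tent_diff_le.
- exact: half_tent_diff_boundary.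
- by move=> w _ wv _ k; rewrite /half_tent_diff (negbTE wv).
Qed.

End OneCell.

(** At level [size v] the tent is the indicator of the vertex [x], seen by [v] and [v'] alone thanks
    to [Fw_meet3]. *)
Lemma outflow_balance v v' i j : size v = size v' -> v != v' ->
  Fw q v (q i) = Fw q v' (q j) -> (forall l, Fw q v (q i) <> q l) ->
  `|(weight r v)^-1 * outflow v i + (weight r v')^-1 * outflow v' j|
    <= K * (mass r v + mass r v').
Proof.
move=> svv vv' e v_notin; set x := Fw q v (q i) in e v_notin *.
pose G w : 'I_3 -> R := fun k => (Fw q w (q k) == x)%:R.
have Gkronecker w k : Fw q w (q k) = x -> G w = kronecker k.
  move=> wx; apply/funext => l; rewrite /G -wx.
  by rewrite (inj_eq (Fw_inj hq (w:=w))) (inj_eq (q_inj hq)).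
have G0 w : size w = size v -> w != v -> w != v' -> forall k, G w k = 0.
  move=> wv nv nv' k; rewrite /G; case: eqP => // wx.
  have [e1|e1|e1] := Fw_meet3 hq svv (esym wv) e (esym wx).
  - by rewrite e1 eqxx in vv'.
  - by rewrite e1 eqxx in nv.
  - by rewrite e1 eqxx in nv'.
have -> : (weight r v)^-1 * outflow v i + (weight r v')^-1 * outflow v' j
    = \sum_(w <- words (size v))
        (weight r w)^-1 * dirichlet (trace q u w) (G w).
  rewrite (bigD1_seq v) ?words_uniq ?mem_words //= -big_filter.
  rewrite (bigD1_seq v') ?filter_uniq ?words_uniq ?mem_filter ?mem_words //=;
    last by rewrite svv eqxx eq_sym vv'.
  rewrite big_filter_cond big_seq_cond big1 ?addr0.
    by rewrite (Gkronecker v i) // (Gkronecker v' j).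
  move=> w /and3P[]; rewrite mem_words => /eqP wv nv nv'.
  have -> : G w = fun=> 0 by apply/funext => k; exact: G0.
  by rewrite /dirichlet; ring.
rewrite -[K]mul1r; apply: weak_form_bound.
- by move=> w w' k l _ _ ww; rewrite /G ww.
- by move=> w k; rewrite /G; case: eqP; rewrite ?normr1 ?normr0.
- move=> l; rewrite /G Fw_nseq; case: eqP => // lx.
  by case: (v_notin l).
- move=> w wv; rewrite take_oversize ?wv // take_oversize ?wv ?svv //.
  exact: G0.
Qed.

End Matching.

(** * Passage to the limit in the difference quotients *)

Lemma cvg_geometric_steps (R : realType) (s : nat -> R) (C z : R) :
  0 <= z < 1 -> (forall m, `|s m - s m.+1| <= C * z ^+ m) -> cvgn s.
Proof.
move=> /andP[z0 z1] step.
have C0 : 0 <= C by have := step 0%N; rewrite expr0 mulr1; apply: le_trans.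
have -> : s = (fun n => s 0%N + series (telescope s) n).
  by apply/funext => n; exact: eq_sum_telescope.
apply: is_cvgD; first exact: is_cvg_cst.
apply: normed_cvg.
apply: (series_le_cvg (v_ := geometric C z)) => [n|n|n|].
- exact: normr_ge0.
- by rewrite mulr_ge0 // exprn_ge0.
- by rewrite /telescope /= distrC; exact: step.
- by apply: is_cvg_geometric_series; rewrite ger0_norm.
Qed.

Section NormalDerivative.
Variables (R : realType) (q : 'I_3 -> plane R).
Hypothesis hq : is_triangle q.
Variable r : R.
Hypothesis r_gt0 : 0 < r.
Variable u : plane R -> R.
Implicit Types (i j : 'I_3) (w : word).

Lemma Fw_cat_nseq w m i x :
  Fw q (w ++ nseq m (i, i)) x = Fw q w (iter m (F2 q (i, i)) x).
Proof. by rewrite Fw_cat; congr (Fw q w _); elim: m => //= m ->. Qed.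

Lemma normal_quotientE w i m : normal_quotient q r (u \o Fw q w) i m
  = (r0 r ^+ m)^-1 * outflow q u (w ++ nseq m (i, i)) i.
Proof.
have iter_q : iter m (F2 q (i, i)) (q i) = q i.
  by elim: m => //= m ->; rewrite /F2 /= !F_q.
by rewrite outflowE !Fw_cat_nseq iter_q.
Qed.

Lemma weight_cat_nseq w m i :
  weight r (w ++ nseq m (i, i)) = weight r w * r0 r ^+ m.
Proof.
rewrite /weight big_cat /=; congr (_ * _); elim: m => [|m ih].
  by rewrite big_nil.
by rewrite /= big_cons ih exprS /scale /= eqxx.
Qed.

Lemma weight_outflow w i m : (weight r (w ++ nseq m (i, i)))^-1
    * outflow q u (w ++ nseq m (i, i)) i
  = (weight r w)^-1 * normal_quotient q r (u \o Fw q w) i m.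
Proof. by rewrite normal_quotientE weight_cat_nseq invfM mulrA. Qed.

Variable SG : set (plane R).
Hypothesis hSG : is_gasket q SG.
Variable res : nat -> plane R -> plane R -> R.
Hypothesis hres : is_resistance q r res.
Variable mu : probability (borel_plane R) R.
Hypothesis hmu : is_selfsimilar_measure q r SG mu.
Hypothesis hu : dom_laplacian q res SG mu u.

Lemma laplacian_bounded : exists f K,
  [/\ has_laplacian q res SG mu u f, 0 <= K & forall x, SG x -> `|f x| <= K].
Proof.
have [f hf] := hu; have [_ cf _] := hf.
by have [K K0 fK] := within_continuous_bounded hSG cf; exists f, K.
Qed.

Lemma has_normal_derivative_junction w i :
  (forall l, Fw q w (q i) <> q l) ->
  has_local_normal_derivative q r w u i.
Proof.
move=> w_notin; have [f [K [hf K0 fK]]] := laplacian_bounded.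
(* [outflow_step] is applied to [w ++ nseq m (i, i)], whose mass carries the factor [mu0 r ^+ m];
   the powers of [r0 r] are absorbed in the normal quotient, leaving [weight r w]. *)
apply: (cvg_geometric_steps (C := weight r w * (K * (mass r w + mass r w)))
  (mu0_lt1 r_gt0)) => m.
have notin l : Fw q (w ++ nseq m (i, i)) (q i) <> q l.
  by rewrite Fw_cat Fw_nseq.
have := outflow_step hq r_gt0 hSG hres hmu hf K0 fK notin.
rewrite mulrBr weight_outflow [X in _ - X]mulrA -invfM.
have -> : rcons (w ++ nseq m (i, i)) (i, i) = w ++ nseq m.+1 (i, i).
  by rewrite -cats1 -catA -(nseqD m 1) addn1.
have -> : weight r (w ++ nseq m (i, i)) * r0 r
    = weight r (w ++ nseq m.+1 (i, i)).
  by rewrite !weight_cat_nseq exprSr mulrA.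
rewrite weight_outflow -mulrBr normrM mass_nseq -mulrDl.
have w0 := weight_gt0 r_gt0 w.
by rewrite gtr0_norm ?invr_gt0 // ler_pdivrMl // !mulrA.
Qed.

Lemma normal_derivative_matching w w' i j : size w = size w' -> w != w' ->
  Fw q w (q i) = Fw q w' (q j) -> (forall l, Fw q w (q i) <> q l) ->
  (weight r w)^-1 * normal_derivative q r (u \o Fw q w) i
    + (weight r w')^-1 * normal_derivative q r (u \o Fw q w') j = 0.
Proof.
move=> ww' nww' e w_notin; have [f [K [hf K0 fK]]] := laplacian_bounded.
have w'_notin l : Fw q w' (q j) <> q l by rewrite -e.
have cw := has_normal_derivative_junction w_notin.
have cw' := has_normal_derivative_junction w'_notin.
pose s m := (weight r w)^-1 * normal_quotient q r (u \o Fw q w) i m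
  + (weight r w')^-1 * normal_quotient q r (u \o Fw q w') j m.
have s_le m : `|s m| <= mu0 r ^+ m * (K * (mass r w + mass r w')).
  have -> : mu0 r ^+ m * (K * (mass r w + mass r w'))
      = K * (mass r (w ++ nseq m (i, i)) + mass r (w' ++ nseq m (j, j))).
    by rewrite !mass_nseq; ring.
  rewrite /s -!weight_outflow.
  apply: (outflow_balance hq r_gt0 hSG hres hmu hf K0 fK).
  - by rewrite !size_cat !size_nseq ww'.
  - by rewrite eqseq_cat // negb_and nww'.
  - by rewrite !Fw_cat !Fw_nseq.
  - by move=> l; rewrite Fw_cat Fw_nseq.
have lim0 : s @ \oo --> (0 : R).
  apply/norm_cvg0P; have /andP[z0 z1] := mu0_lt1 r_gt0.
  apply: (squeeze_cvgr (f := cst 0)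
    (h := fun m => mu0 r ^+ m * (K * (mass r w + mass r w')))).
  - by apply: nearW => m; rewrite normr_ge0 s_le.
  - exact: cvg_cst.
  - rewrite -[X in _ --> X](mul0r (K * (mass r w + mass r w'))).
    by apply: cvgMl; apply: cvg_expr; rewrite ger0_norm.
apply: cvg_unique lim0 => //.
by apply: cvgD; apply: cvgMr; [exact: cw|exact: cw'].
Qed.

End NormalDerivative.

Theorem theorem1p2 (R : realType) (q : 'I_3 -> plane R) (hq : is_triangle q)
  (r : R) (hr : 0 < r)
  (SG : set (plane R)) (hSG : is_gasket q SG)
  (res : nat -> plane R -> plane R -> R) (hres : is_resistance q r res)
  (mu : probability (borel_plane R) R)
  (hmu : is_selfsimilar_measure q r SG mu)
  (u : plane R -> R) (hu : dom_laplacian q res SG mu u)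
  (x : plane R) (hx : junction q x)
  (w w' : word) (hsize : size w = size w')
  (i j : 'I_3) (hwx : x = Fw q w (q i)) (hw'x : x = Fw q w' (q j))
  (hcells : Fw q w @` SG <> Fw q w' @` SG)
  (y1 y3 : plane R) (hy1 : y1 = Fw q w (q (i - 1)))
  (hy3 : y3 = Fw q w' (q (j - 1))) :
  [/\ has_local_normal_derivative q r w u i,
      has_local_normal_derivative q r w' u j,
      res (size w) x y1 = res (size w) x y3 ->
        local_normal_derivative q r w u i
          + local_normal_derivative q r w' u j = 0
    & r * res (size w) x y1 = res (size w) x y3 ->
        r * local_normal_derivative q r w u i
          + local_normal_derivative q r w' u j = 0].
Proof.
have [_ xV0] := hx.
have w_notin l : Fw q w (q i) <> q l.
  by rewrite -hwx => e; apply: xV0; exists l.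
have w'_notin l : Fw q w' (q j) <> q l.
  by rewrite -hw'x => e; apply: xV0; exists l.
have ww' : w != w' by apply: contra_not_neq hcells => ->.
have pred_neq (k : 'I_3) : k != k - 1 by elim/I3_ind: k.
have res1 : res (size w) x y1 = weight r w.
  by rewrite hy1 hwx (res_weight hres) // pred_neq.
have res3 : res (size w) x y3 = weight r w'.
  by rewrite hsize hy3 hw'x (res_weight hres) // pred_neq.
have := normal_derivative_matching hq hr hSG hres hmu hu hsize ww'
  (etrans (esym hwx) hw'x) w_notin.
have W0 := weight_gt0 hr w.
(* Both local derivatives now carry the same factor [lambda_sym r ^- size w], so only the relation
   between [N] and [N'] matters. *)
rewrite res1 res3 /local_normal_derivative -hsize.
set N := normal_derivative _ _ _ i; set N' := normal_derivative _ _ _ j => bal.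
have Wn : weight r w != 0 by rewrite gt_eqF.
have rn : r != 0 by rewrite gt_eqF.
split.
- exact: (has_normal_derivative_junction hq hr hSG hres hmu hu w_notin).
- exact: (has_normal_derivative_junction hq hr hSG hres hmu hu w'_notin).
- move=> e; rewrite -e -mulrDr in bal; move/eqP: bal.
  rewrite mulf_eq0 invr_eq0 (negbTE Wn) /= => /eqP NN.
  by rewrite -mulrDr NN mulr0.
- move=> e; rewrite -e in bal.
  have NN : r * N + N' = 0.
    (* The multiplier is the resistance of the second cell, and clears both denominators. *)
    have := congr1 (fun z => r * weight r w * z) bal.
    rewrite /= mulr0 => <-; field.
    by rewrite rn Wn.
  by rewrite mulrCA -mulrDr NN mulr0.
Qed.
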